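(* Let $(X,\Sigma_d)$ be an arbitrary discrete space and let $P(x,E)$, $x\in X$, $E\in\Sigma_d$, be a countably additive sub-Markov kernel on $(X,\Sigma_d)$ such that $P(x,X)>0$ for all $x\in X$. Then for every $x\in X$ the measure $P(x,\cdot)$ is atomic and has a finite or countable support $D(x)=\{x_1(x),x_2(x),\dots\}\subset X$ for which $P(x,\{x_n(x)\})=\alpha_n(x)>0$ for every index $n$, $\sum_n\alpha_n(x)=P(x,D(x))=P(x,X)$, and $P(x,X\setminus D(x))=0$.
   Context: ''Arbitrary discrete space'' $(X,\Sigma_d)$: $X$ is an infinite set, $\Sigma_d=2^X$ is the sigma-algebra of all subsets of $X$, and the cardinality of $X$ is ''immeasurable'', meaning that every finite countably additive measure on $2^X$ that is zero on every one-point set is identically zero. A countably additive sub-Markov kernel on $(X,\Sigma_d)$ is a function $P(x,E)$, $x\in X$, $E\in\Sigma_d$, such that $0\le P(x,E)\le 1$ for all $x,E$; $P(\cdot,E)$ is a bounded $\Sigma_d$-measurable function for every $E$ (automatic here); and $P(x,\cdot)$ is a bounded countably additive measure on $\Sigma_d$ for every $x$. A bounded countably additive measure $\mu\ge 0$ is called atomic (discrete) if it has a support (set of full measure) $D$ consisting of a finite or countable family of its atoms, i.e. of points $x$ with $\mu(\{x\})\neq 0$; thus $D=\{x_1,x_2,\dots\}$ and $\mu(D)=\sum_n\mu(\{x_n\})=\mu(X)$. *)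

(* Defs.v *)
From HB Require Import structures.
From mathcomp Require Import all_boot all_order all_algebra.
From mathcomp Require Import all_classical all_reals all_analysis.

Set Implicit Arguments.
Unset Strict Implicit.
Unset Printing Implicit Defensive.

Import Order.TTheory GRing.Theory Num.Theory.
Import numFieldNormedType.Exports.

Local Open Scope classical_set_scope.
Local Open Scope ring_scope.
Local Open Scope ereal_scope.

Definition discrete_sigma_algebra (d : measure_display) (X : measurableType d) : Prop :=
  forall A : set X, measurable A.

(* Meant for a discrete sigma-algebra, where the sets [set x] are measurable. *)
Definition immeasurable (R : realType) (d : measure_display)
    (X : measurableType d) : Prop :=
  forall mu : {finite_measure set X -> \bar R},
    (forall x : X, mu [set x] = 0) -> forall A : set X, measurable A -> mu A = 0.

Definition arbitrary_discrete_space (R : realType) (d : measure_display)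
    (X : measurableType d) : Prop :=
  [/\ infinite_set [set: X], discrete_sigma_algebra X & immeasurable R X].

Definition atom (R : realType) (d : measure_display) (X : measurableType d)
    (mu : {measure set X -> \bar R}) (x : X) : Prop :=
  mu [set x] <> 0.

Definition atomic (R : realType) (d : measure_display) (X : measurableType d)
    (mu : {measure set X -> \bar R}) : Prop :=
  mu [set: X] < +oo /\
  exists D : set X,
    [/\ countable D, forall x, D x -> atom mu x,
        mu D = \esum_(x in D) mu [set x] & mu D = mu [set: X]].

(* D = {u 0, u 1, ...} without repetition; the index set I is an initial
   segment of nat, so that the list is finite or infinite. *)
Definition enumerates (T : Type) (I : set nat) (u : nat -> T) (D : set T) : Prop :=
  (I = [set: nat] \/ exists N : nat, I = `I_N) /\ set_bij I D u.

(* Main.v *)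
Require Import Defs.
From HB Require Import structures.
From mathcomp Require Import all_boot all_order all_algebra finmap.
From mathcomp Require Import all_classical all_reals all_analysis.

Set Implicit Arguments.
Unset Strict Implicit.
Unset Printing Implicit Defensive.

Import Order.TTheory GRing.Theory Num.Theory.
Import numFieldNormedType.Exports.

Local Open Scope classical_set_scope.
Local Open Scope ring_scope.
Local Open Scope ereal_scope.

(** The set [D] of atoms of [mu := P x] is the support.  It is countable because
    [mu] is finite: [k] points of mass at least [e] have total mass at least
    [k * e], so only finitely many atoms have mass at least [1 / n.+1], and [D]
    is the union of these finite sets over [n] ([countable_atoms]).  The
    restriction of [mu] to the complement of [D] is a finite measure that
    vanishes on every point, so immeasurability of the space makes it vanish
    identically: [mu (~` D) = 0] ([measure_setC_atoms]).  Therefore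
    [mu D = mu X], and countable additivity along an injective enumeration of
    [D] ([countable_enumerates]) turns [mu D] into the sum of the masses of the
    atoms ([measure_enumerates]). *)

Lemma countable_enumerates (T : Type) (t0 : T) (D : set T) :
  countable D -> exists (I : set nat) (u : nat -> T), enumerates I u D.
Proof.
(* An inhabitant of [T] is needed as the value of [u] outside of [I]. *)
elim/Ppointed: T => T in t0 D *; first by have := no t0.
move=> cD.
have [/finite_setP[n Dn]|infD] := pselect (finite_set D).
  have /card_set_bijP[u uP] : (`I_n #= D)%card by exact: card_esym.
  by exists `I_n, u; split => //; right; exists n.
have /card_esym/card_set_bijP[u uP] := eq_card_nat cD infD.
by exists setT, u; split => //; left.
Qed.

Section discrete_part.
Context (R : realType) (d : measure_display) (X : measurableType d).
Variable mu : {measure set X -> \bar R}.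
Hypothesis m1 : forall x : X, measurable [set x].

Let trivIset_set1 (D : set X) : trivIset D (fun x : X => [set x]).
Proof. by move=> x y _ _ [z [/= -> ->]]. Qed.

Lemma finite_heavy_points (e : R) : (0 < e)%R -> mu [set: X] < +oo ->
  finite_set [set x | e%:E <= mu [set x]].
Proof.
move=> e0 muT; apply: contrapT => infA.
have muTfin : mu [set: X] \is a fin_num by rewrite ge0_fin_numE.
set M := fine (mu [set: X]).
(* More than [M / e] points of mass at least [e] would outweigh the space. *)
have [B BA Bcard] := infinite_set_fset (Num.truncn (M / e)).+1 infA.
have mB : measurable [set` B].
  by apply: countable_measurable => //; exact: countable_fset.
have : mu [set` B] <= mu [set: X] by apply: le_measure; rewrite ?inE.
apply/negP; rewrite -ltNge -(fineK muTfin) -/M.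
rewrite -(image_id [set` B]) -bigcup_imset1 bigcup_fset measure_fbigsetU//.
apply: (@lt_le_trans _ _ (\sum_(x <- B) e%:E)); last first.
  by rewrite big_seq [leRHS]big_seq; apply: lee_sum => x /BA.
rewrite sumEFin lte_fin.
rewrite big_const_seq count_predT iter_addr_0 -mulr_natl -ltr_pdivrMr//.
rewrite (lt_le_trans (truncnS_gt _))// ler_nat.
exact: Bcard.
Qed.

Lemma countable_atoms : mu [set: X] < +oo -> countable [set x | atom mu x].
Proof.
move=> muT.
have -> : [set x | atom mu x] =
    \bigcup_(n in [set: nat]) [set x | (n.+1%:R^-1)%:E <= mu [set x]].
  apply/seteqP; split => [x /= ax|x [n _ /=] le_n mux0]; last first.
    by move: le_n; rewrite mux0 lee_fin leNgt invr_gt0 ltr0n.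
  have muxfin : mu [set x] \is a fin_num.
    rewrite ge0_fin_numE// (le_lt_trans _ muT)//.
    by apply: le_measure; rewrite ?inE.
  have mux_gt0 : (0 < fine (mu [set x]))%R.
    by rewrite -lte_fin fineK// lt0e measure_ge0 andbT; exact/eqP.
  exists (Num.truncn (fine (mu [set x]))^-1) => //=.
  rewrite -(fineK muxfin) lee_fin invf_ple ?posrE//.
  exact/ltW/truncnS_gt.
apply: bigcup_countable => // n _.
by apply/finite_set_countable/finite_heavy_points => //; rewrite invr_gt0.
Qed.

Lemma measure_enumerates (D : set X) (I : set nat) (u : nat -> X) :
  enumerates I u D -> \sum_(n <oo | n \in I) mu [set u n] = mu D.
Proof.
move=> [_ [funu injud surju]].
have -> : D = \bigcup_(n in I) [set u n].
  apply/seteqP; split => [x /surju[n In <-]|x [n In ->]]; first by exists n.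
  exact: funu.
by rewrite measure_bigcup// => i j Ii Ij [x [/= -> /injud]]; apply; rewrite inE.
Qed.

Lemma esum_enumerates (D : set X) (I : set nat) (u : nat -> X) :
  enumerates I u D -> \esum_(x in D) mu [set x] = mu D.
Proof.
move=> uD; rewrite -(measure_enumerates uD) nneseries_esum// set_mem_set.
by case: uD => _; exact: (reindex_esum I D u).
Qed.

(** Immeasurability applies to the restriction of [mu] to the complement of
    its atoms: a point carries mass for the restriction only if it is an atom
    outside of the set of atoms. *)
Lemma measure_setC_atoms : immeasurable R X -> mu [set: X] < +oo ->
  mu (~` [set x | atom mu x]) = 0.
Proof.
move=> immX muT; set N := ~` _.
have mN : measurable N.
  by apply/measurableC/countable_measurable => //; exact: countable_atoms.
have muN : mu N < +oo.
  by rewrite (le_lt_trans _ muT)//; apply: le_measure; rewrite ?inE.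
rewrite -[N]setTI; apply: (immX (mfrestr mN muN)) => // x.
rewrite /= /mfrestr /mrestr.
have [Nx|Nx] := pselect (N x).
  by rewrite setIidl; [exact: contrapT|move=> _ ->].
by rewrite (_ : _ `&` _ = set0)// -subset0 => y [/= -> /Nx].
Qed.

End discrete_part.

Theorem theorem3p4 (R : realType) (d : measure_display) (X : measurableType d)
    (hX : arbitrary_discrete_space R X)
    (P : R.-spker X ~> X)
    (hP : forall x : X, 0 < P x [set: X]) :
  forall x : X,
    atomic (P x) /\
    exists (D : set X) (I : set nat) (u : nat -> X) (alpha : nat -> R),
      [/\ enumerates I u D,
          forall n : nat, I n -> P x [set u n] = (alpha n)%:E /\ (0 < alpha n)%R,
          \sum_(n <oo | n \in I) (alpha n)%:E = P x D,
          P x D = P x [set: X] &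
          P x (~` D) = 0].
Proof.
case: hX => _ discX immX x.
have m1 (y : X) : measurable [set y] by exact: discX.
have PxT : P x [set: X] < +oo.
  by rewrite (le_lt_trans (sprob_kernel_le1 P x))// ltry.
have finPx A : P x A \is a fin_num.
  by apply: kernel_finite_transition; exact: discX.
set D := [set y | atom (P x) y].
have cD : countable D by exact: countable_atoms.
have PxC : P x (~` D) = 0 by exact: measure_setC_atoms.
have PxD : P x D = P x [set: X].
  rewrite -(setUv D) measureU ?setICr//; [|exact: discX..].
  by rewrite [X in _ + X]PxC adde0.
have [I [u uD]] := countable_enumerates x cD.
split.
  split => //; exists D; split => //.
  by rewrite (esum_enumerates _ m1 uD).
exists D, I, u, (fun n => fine (P x [set u n])); split => //.
  move=> n In; rewrite fineK//; split => //.
  have Dun : D (u n) by case: uD => _ [+ _ _]; apply.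
  by rewrite -lte_fin fineK// lt0e measure_ge0 andbT; exact/eqP.
rewrite -(measure_enumerates _ m1 uD).
by apply: eq_eseriesr => n _; rewrite fineK.
Qed.
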